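(* For the class of all finite simple undirected graphs $G=(V,E)$ each with a distinguished vertex $w\in V$, the following two problems are polynomial-time reducible to each other: (i) computing a linear arrangement of $G$ that is $\beta$-optimal relative to anchor $w$; (ii) computing a linear reassembling of $G$ that is $\beta$-optimal relative to anchor $w$. That is, there is a polynomial-time algorithm which, given $(G,w)$ and access to a procedure solving (ii) [resp. (i)] on arbitrary inputs of the class, outputs a solution of (i) [resp. (ii)] for $(G,w)$.
   Context: Let $n=|V|$. For $X\subseteq V$, $\deg_G(X)$ is the number of edges with exactly one endpoint in $X$. A linear binary tree over $V$ is a collection $\mathcal{L}=\{\{v_j\}\mid 1\le j\le n\}\cup\{\{v_1,\dots,v_k\}\mid 2\le k\le n\}$ for some enumeration $v_1,\dots,v_n$ of $V$; $(G,\mathcal{L})$ is a linear reassembling with $\beta(G,\mathcal{L})=\sum_{X\in\mathcal{L}}\deg_G(X)$. It is anchored at $w$ if its smallest non-singleton cluster is $\{w,w'\}$ for some $w'$ with $\deg_G(w)\le\deg_G(w')$. A linear arrangement is a bijection $\varphi:V\to\{1,\dots,n\}$ with $\beta(G,\varphi)=\sum_{i=1}^{n}\deg_G(\{v\mid\varphi(v)\le i\})$; it is anchored at $w$ if $\varphi(w)=1$ and $\varphi(w')=2$ for some $w'$ with $\deg_G(w)\le\deg_G(w')$. A linear reassembling (resp. arrangement) anchored at $w$ is $\beta$-optimal relative to anchor $w$ if its $\beta$ value is minimal among all linear reassemblings (resp. arrangements) of $G$ anchored at $w$. *)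

(* Defs.v *)
From HB Require Import structures.
From mathcomp Require Import all_boot all_order all_algebra.

Set Implicit Arguments.
Unset Strict Implicit.
Unset Printing Implicit Defensive.

Record sgraph (V : finType) := SGraph {
  edges : {set {set V}};
  edges_card2 : [forall f in edges, #|f| == 2]
}.

Section Graphs.
Variables (V : finType) (G : sgraph V).

Definition deg (X : {set V}) : nat := #|[set f in edges G | #|f :&: X| == 1]|.

Definition vdeg (v : V) : nat := deg [set v].

Definition linear_tree_of (s : #|V|.-tuple V) : {set {set V}} :=
  [set [set v] | v in s]
    :|: [set [set v in take k s] | k : 'I_#|V|.+1 & 2 <= k].

Definition linear_tree (L : {set {set V}}) : Prop :=
  exists2 s : #|V|.-tuple V, uniq s & L = linear_tree_of s.

Definition beta_reassembling (L : {set {set V}}) : nat := \sum_(X in L) deg X.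

Definition smallest_nonsingleton (L : {set {set V}}) (X : {set V}) : Prop :=
  [/\ X \in L, #|X| != 1
    & forall Y : {set V}, Y \in L -> #|Y| != 1 -> X \subset Y].

Definition reassembling_anchored (w : V) (L : {set {set V}}) : Prop :=
  exists2 w', smallest_nonsingleton L [set w; w'] & vdeg w <= vdeg w'.

Definition optimal_reassembling (w : V) (L : {set {set V}}) : Prop :=
  [/\ linear_tree L, reassembling_anchored w L
    & forall L' : {set {set V}}, linear_tree L' -> reassembling_anchored w L' ->
        beta_reassembling L <= beta_reassembling L'].

(* phi is a bijection from V onto {1, ..., |V|}; positions are 1-based. *)
Definition arrangement (phi : {ffun V -> nat}) : Prop :=
  [/\ forall v, 1 <= phi v <= #|V|,
      injective phi
    & forall i, 1 <= i <= #|V| -> exists v, phi v = i].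

Definition beta_arrangement (phi : {ffun V -> nat}) : nat :=
  \sum_(1 <= i < #|V|.+1) deg [set v | phi v <= i].

Definition arrangement_anchored (w : V) (phi : {ffun V -> nat}) : Prop :=
  phi w = 1 /\ exists2 w', phi w' = 2 & vdeg w <= vdeg w'.

Definition optimal_arrangement (w : V) (phi : {ffun V -> nat}) : Prop :=
  [/\ arrangement phi, arrangement_anchored w phi
    & forall phi' : {ffun V -> nat},
        arrangement phi' -> arrangement_anchored w phi' ->
        beta_arrangement phi <= beta_arrangement phi'].

End Graphs.

Definition word := seq bool.

(* None is the blank symbol. *)
Definition cell := option bool.

Inductive dir := MoveL | Stay | MoveR.

(* The tape is two-way infinite. [lcells] lists the cells to the left of the head,
   nearest first; [rcells] those to the right; all cells not listed are blank. *)
Record tape := Tape { lcells : seq cell; scanned : cell; rcells : seq cell }.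

Definition tape_move (d : dir) (t : tape) : tape :=
  match d with
  | MoveL => Tape (behead (lcells t)) (head None (lcells t)) (scanned t :: rcells t)
  | Stay => t
  | MoveR => Tape (scanned t :: lcells t) (head None (rcells t)) (behead (rcells t))
  end.

Definition tape_write (c : cell) (t : tape) : tape := Tape (lcells t) c (rcells t).

(* The tape that contains just x, with the head on its first letter. *)
Definition tape_of_word (x : word) : tape :=
  let cs := map Some x in Tape [::] (head None cs) (behead cs).

Fixpoint until_blank (cs : seq cell) : word :=
  if cs is Some b :: cs' then b :: until_blank cs' else [::].

(* The word that starts at the head and extends to the first blank. *)
Definition word_of_tape (t : tape) : word := until_blank (scanned t :: rcells t).

Inductive mode := Run | Query | Halt.

Record oracle_tm := OracleTM {
  state : finType;
  tape_id : finType;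
  start : state;
  in_tape : tape_id;
  query_tape : tape_id;
  out_tape : tape_id;
  state_mode : state -> mode;
  trans : state -> {ffun tape_id -> cell} ->
          state * {ffun tape_id -> cell * dir};
  after_query : state -> state
}.

Section Run.
Variables (M : oracle_tm) (O : word -> word).

Definition config := (state M * {ffun tape_id M -> tape})%type.

Definition init (x : word) : config :=
  (start M, [ffun i => tape_of_word (if i == in_tape M then x else [::])]).

(* In a query state the content of the query tape is replaced, in one step, by
   the answer of the oracle. *)
Definition step (c : config) : config :=
  let: (q, ts) := c in
  match state_mode q with
  | Halt => c
  | Query =>
      (after_query q,
       [ffun i => if i == query_tape M
                  then tape_of_word (O (word_of_tape (ts i))) else ts i])
  | Run =>
      let: (q', act) := trans q [ffun i => scanned (ts i)] in
      (q', [ffun i => tape_move (act i).2 (tape_write (act i).1 (ts i))])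
  end.

Definition outputs_within (x : word) (t : nat) (y : word) : Prop :=
  let: (q, ts) := iter t step (init x) in
  state_mode q = Halt /\ word_of_tape (ts (out_tape M)) = y.

End Run.

Record search_problem := SearchProblem {
  instance : Type;
  encode : instance -> word;
  solution : instance -> word -> Prop
}.

(* An instance need not have a solution (for example, no arrangement is anchored
   at w if every other vertex has smaller degree); the correct answer is then
   the one-letter word 0, whereas a solution is announced by a leading 1. *)
Definition correct_answer (P : search_problem) (x : instance P) (y : word) :
    Prop :=
  (exists2 s, solution x s & y = true :: s) \/
  (y = [:: false] /\ forall s, ~ solution x s).

Definition solves (P : search_problem) (O : word -> word) : Prop :=
  forall x : instance P, correct_answer x (O (encode x)).

Definition poly_time_reducible (P Q : search_problem) : Prop :=
  exists (M : oracle_tm) (p : {poly nat}),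
    forall O : word -> word, solves Q O ->
    forall x : instance P, exists (t : nat) (y : word),
      [/\ t <= p.[size (encode x)]%R,
          outputs_within M O (encode x) t y
        & correct_answer x y].

Record anchored_graph := AnchoredGraph {
  nb_vertices : nat;
  graph : sgraph 'I_nb_vertices;
  anchor : 'I_nb_vertices
}.

Definition unary (k : nat) : word := rcons (nseq k true) false.

(* The number of vertices in unary, the adjacency matrix by rows, the anchor in unary. *)
Definition encode_graph (x : anchored_graph) : word :=
  unary (nb_vertices x)
    ++ [seq [set u; v] \in edges (graph x)
       | u <- enum 'I_(nb_vertices x), v <- enum 'I_(nb_vertices x)]
    ++ unary (anchor x).

(* The positions phi 0, ..., phi (n-1) in unary. *)
Definition encode_arrangement n (phi : {ffun 'I_n -> nat}) : word :=
  flatten [seq unary (phi v) | v <- enum 'I_n].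

Definition char_vector n (X : {set 'I_n}) : word :=
  [seq v \in X | v <- enum 'I_n].

(* y lists the characteristic vectors of the clusters of L, each one once, in
   any order. *)
Definition encodes_clusters n (L : {set {set 'I_n}}) (y : word) : Prop :=
  exists cs : seq {set 'I_n},
    [/\ uniq cs, cs =i L & y = flatten [seq char_vector X | X <- cs]].

Definition arrangement_problem : search_problem :=
  @SearchProblem anchored_graph encode_graph
    (fun x y => exists2 phi,
       optimal_arrangement (graph x) (anchor x) phi
       & y = encode_arrangement phi).

Definition reassembling_problem : search_problem :=
  @SearchProblem anchored_graph encode_graph
    (fun x y => exists2 L,
       optimal_reassembling (graph x) (anchor x) L
       & encodes_clusters L y).

(* Main.v *)
(* For an enumeration v_1, ..., v_n with v_1 = w the linear reassembling costs the
   sum of all vertex degrees minus deg w more than the linear arrangement, and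
   this difference does not depend on the enumeration. A linear tree determines
   its enumeration up to exchanging v_1 and v_2, so the two anchored problems have
   the same optimal enumerations, and one oracle call on the unchanged input
   suffices; only the output has to be converted. The position of v <> w is
   n + 2 minus the number of clusters that contain v. Conversely, the bit of v in
   the j-th of the 2n - 1 clusters is the letter number j + phi v - 1 of the word
   1^n 0^(n-1) 1. *)
Require Import Defs.
From mathcomp Require Import all_boot all_order all_algebra.
From mathcomp Require Import zify.

Set Implicit Arguments.
Unset Strict Implicit.
Unset Printing Implicit Defensive.

(** * Structured programs for oracle Turing machines *)

(** The conversions are easy on paper, but the statement asks for concrete machines. They are
    therefore written as structured flowcharts, and their behaviour is derived in a Hoare logic that
    also bounds the number of steps. The programs avoid arithmetic: numbers are lengths of unary
    words or head positions, and [n] is kept in unary as a ruler that paces the moves. Counting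
    clusters makes the arbitrary order of the oracle's list harmless, with no sorting or comparison
    of clusters. The word [1^n 0^(n-1) 1] makes all clusters, prefixes and singletons alike,
    readable by one routine that is applied to a word losing its first letter each time. Equality of
    the optimal enumerations also shows that both problems are solvable on the same instances, so a
    negative answer is simply passed on. *)

Definition tapes := {ffun 'I_6 -> tape}.

Definition inT : 'I_6 := @Ordinal 6 0 isT.
Definition queryT : 'I_6 := @Ordinal 6 1 isT.
Definition outT : 'I_6 := @Ordinal 6 2 isT.
Definition sizeT : 'I_6 := @Ordinal 6 3 isT.
Definition workT : 'I_6 := @Ordinal 6 4 isT.
Definition loopT : 'I_6 := @Ordinal 6 5 isT.

(** Every instruction acts on at most one tape, so its effect on a list of six tapes is at most one
    [set_nth]. *)
Inductive instr (S : Type) :=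
  | Do of 'I_6 & (cell -> cell) & dir & S
  | Test of 'I_6 & (cell -> S)
  | Ask of S.

Definition instr_map S S' (f : S -> S') (a : instr S) : instr S' :=
  match a with
  | Do i g d s => Do i g d (f s)
  | Test i k => Test i (f \o k)
  | Ask s => Ask (f s)
  end.

(* The successor [None] of a node is the exit of the flowchart. *)
Record flowchart := Flowchart {
  node : finType;
  entry : node;
  code : node -> instr (option node)
}.

Definition machine_of (F : flowchart) : oracle_tm :=
  @OracleTM (option (node F)) 'I_6 (Some (entry F)) inT queryT outT
    (fun o => if o is Some q then
                if code q is Ask _ then Query else Run
              else Halt)
    (fun o cs => if o is Some q then
       match code q with
       | Do i g d s =>
           (s, [ffun j => if j == i then (g (cs j), d) else (cs j, Stay)])
       | Test i k => (k (cs i), [ffun j => (cs j, Stay)])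
       | Ask s => (s, [ffun j => (cs j, Stay)])
       end else (None, [ffun j => (cs j, Stay)]))
    (fun o => if o is Some q then if code q is Ask s then s else None else None).

Definition do_chart i g d : flowchart :=
  @Flowchart unit tt (fun _ => Do i g d None).

Definition ask_chart : flowchart := @Flowchart unit tt (fun _ => Ask None).

(** A flowchart has an entry node and cannot be empty; doing nothing costs one test whose outcome is
    ignored. *)
Definition skip_chart : flowchart :=
  @Flowchart unit tt (fun _ => Test inT (fun _ => None)).

Definition seq_chart (F G : flowchart) : flowchart :=
  @Flowchart (node F + node G)%type (inl (entry F))
    (fun q => match q with
     | inl q => instr_map
         (fun o => Some (if o is Some q' then inl q' else inr (entry G))) (code q)
     | inr q => instr_map (omap inr) (code q)
     end).

Definition branch_chart i (t : cell -> bool) (F G : flowchart) : flowchart :=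
  @Flowchart (option (node F + node G)) None
    (fun q => match q with
     | None => Test i (fun c => Some (Some (if t c then inl (entry F)
                                            else inr (entry G))))
     | Some (inl q) => instr_map (omap (Some \o inl)) (code q)
     | Some (inr q) => instr_map (omap (Some \o inr)) (code q)
     end).

Definition while_chart i (t : cell -> bool) (F : flowchart) : flowchart :=
  @Flowchart (option (node F)) None
    (fun q => match q with
     | None => Test i (fun c => if t c then Some (Some (entry F)) else None)
     | Some q => instr_map Some (code q)
     end).

Declare Scope chart_scope.
Delimit Scope chart_scope with chart.
Notation "F ;; G" := (seq_chart F G)
  (at level 60, right associativity) : chart_scope.
Bind Scope chart_scope with flowchart.

(* An abstract tape: the cells to the left of the head, nearest first, and those
   from the head on, both up to trailing blanks. *)
Definition atape := (seq cell * seq cell)%type.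

Notation blank := (([::], [::]) : atape).

(** Equality under [nth None] is equality up to trailing blanks. Reading up to the first blank
    respects it, so queries and outputs can be read off abstract tapes. *)
Lemma until_blank_eq l l' :
  nth None l =1 nth None l' -> until_blank l = until_blank l'.
Proof.
elim: l l' => [|c l IH] [|c' l'] e; rewrite ?nth_nil //=.
- by have := e 0; rewrite /= => <-.
- by have := e 0; rewrite /= => ->.
- have := e 0; rewrite /= => ->; rewrite (IH l') // => k; exact: (e k.+1).
Qed.

(** * Time-bounded Hoare logic for flowcharts *)

Section Execution.
Variable O : word -> word.

Definition exec S (a : instr S) (ts : tapes) : S * tapes :=
  match a with
  | Do i g d s =>
      (s, [ffun j => if j == i
                     then tape_move d (tape_write (g (scanned (ts j))) (ts j))
                     else ts j])
  | Test i k => (k (scanned (ts i)), ts)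
  | Ask s =>
      (s, [ffun j => if j == queryT
                     then tape_of_word (O (word_of_tape (ts j))) else ts j])
  end.

Lemma exec_map S S' (f : S -> S') a ts :
  exec (instr_map f a) ts = (f (exec a ts).1, (exec a ts).2).
Proof. by case: a. Qed.

Inductive steps (F : flowchart) :
    nat -> option (node F) * tapes -> option (node F) * tapes -> Prop :=
  | steps0 c : steps 0 c c
  | stepsS k q ts c : steps k (exec (code q) ts) c ->
      steps k.+1 (Some q, ts) c.

Lemma steps_trans F a b (c c' c'' : option (node F) * tapes) :
  steps a c c' -> steps b c' c'' -> steps (a + b) c c''.
Proof.
elim=> {a c c'} [//|k q ts c _ IH /IH]; rewrite addSn; exact: stepsS.
Qed.

(** A composite chart contains its parts up to a renaming of nodes that redirects the exit. A run of
    a part is carried over with the same tapes and the same number of steps. *)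
Lemma steps_sim (F G : flowchart) (h : option (node F) -> option (node G))
    (g : node F -> node G) k c c' :
  (forall q, h (Some q) = Some (g q)) ->
  (forall q, code (g q) = instr_map h (code q)) ->
  steps k c c' -> steps k (h c.1, c.2) (h c'.1, c'.2).
Proof.
move=> hS hc; elim=> {k c c'} [c|k q ts c _ IH]; first exact: steps0.
by rewrite /= hS; apply: stepsS; rewrite hc exec_map.
Qed.

Lemma steps_machine F k c c' :
  steps (F := F) k c c' -> iter k (@step (machine_of F) O) c = c'.
Proof.
elim=> {k c c'} [//|k q ts c _ <-]; rewrite iterSr; congr (iter _ _ _) => /=.
case: (code q) => [i g d s|i f|s] //=; rewrite ?ffunE; congr (_, _).
(* On the tapes that the instruction leaves alone, the machine writes back the scanned cell and
   stays. *)
- apply/ffunP=> j; rewrite !ffunE; case: eqP => _ //=.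
  by case: (ts j).
- by apply/ffunP=> j; rewrite !ffunE /=; case: (ts j).
Qed.

Definition atape_eq (p p' : atape) :=
  nth None p.1 =1 nth None p'.1 /\ nth None p.2 =1 nth None p'.2.

Definition tape_cells (t : tape) : atape := (lcells t, scanned t :: rcells t).

Definition represents (ts : tapes) (A : seq atape) :=
  forall i : 'I_6, atape_eq (tape_cells (ts i)) (nth blank A i).

(** A Hoare triple for total correctness: [A] and [A'] describe the tapes before and after, and [b]
    bounds the number of steps. *)
Definition runs (F : flowchart) (A : seq atape) (b : nat) (A' : seq atape) :=
  forall ts, represents ts A -> exists k ts',
    [/\ k <= b, steps (F := F) k (Some (entry F), ts) (None, ts')
      & represents ts' A'].

Lemma runs_le F A b b' A' : runs F A b A' -> b <= b' -> runs F A b' A'.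
Proof.
move=> H le ts /H[k [ts' [kb ? ?]]]; exists k, ts'; split=> //.
exact: leq_trans le.
Qed.

Lemma runs_eq F A b A' A'' :
  runs F A b A' ->
  (forall i : 'I_6, atape_eq (nth blank A' i) (nth blank A'' i)) ->
  runs F A b A''.
Proof.
move=> H e ts /H[k [ts' [kb ? r]]]; exists k, ts'; split=> // i.
by have [a1 a2] := r i; have [e1 e2] := e i; split=> j; rewrite ?a1 ?a2.
Qed.

Lemma runs_set F A b (i : 'I_6) p p' :
  runs F A b (set_nth blank A i p) -> atape_eq p p' ->
  runs F A b (set_nth blank A i p').
Proof.
move=> H e; apply: (runs_eq H) => j; rewrite !nth_set_nth /=.
by case: eqP.
Qed.

Lemma runs_do (i : 'I_6) g d A :
  let p := nth blank A i in
  let q := (p.1, g (head None p.2) :: behead p.2) in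
  runs (do_chart i g d) A 1 (set_nth blank A i
    match d with
    | MoveL => (behead q.1, head None q.1 :: q.2)
    | Stay => q
    | MoveR => (head None q.2 :: q.1, behead q.2)
    end).
Proof.
move=> p q ts r; set a := Do i g d (None : option unit).
exists 1, (exec a ts).2; split=> //; first exact: stepsS (steps0 _).
move=> j; rewrite /= ffunE nth_set_nth /= -val_eqE /=.
case: (altP (val j =P val i)) => [/val_inj-> {j}|_]; last exact: r.
have := r i; rewrite -/p; have {}r : p = nth blank A i by [].
rewrite {}/q; move: p {r} => [l0 r0] [/=].
case: (ts i) => l c r /= el er.
have ec : c = head None r0 by rewrite -nth0 -er.
rewrite -{}ec.
have er' : nth None r =1 nth None (behead r0).
  by move=> k; rewrite nth_behead -er.
have el' : nth None (behead l) =1 nth None (behead l0).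
  by move=> k; rewrite !nth_behead el.
have hl : head None l = head None l0 by rewrite -!nth0 el.
have hr : head None r = head None (behead r0) by rewrite -!nth0 er'.
have er'' : nth None (behead r) =1 nth None (behead (behead r0)).
  by move=> k; rewrite !nth_behead er' nth_behead.
case: d @a => a /=; split=> -[|k] //=; rewrite ?hl ?hr //.
- by case: k.
- by have:= er'' k; rewrite !nth_behead.
Qed.

Lemma runs_ask A :
  let p := nth blank A queryT in
  runs ask_chart A 1 (set_nth blank A queryT
    ([::], map Some (O (until_blank p.2)))).
Proof.
move=> p ts r; exists 1, (exec (Ask (None : option unit)) ts).2.
split=> //; first exact: stepsS (steps0 _).
move=> j; rewrite /= ffunE nth_set_nth /= -val_eqE /=.
case: (altP (val j =P 1)) => [e|_]; last exact: r.
have {e}-> : j = queryT by exact: val_inj.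
rewrite /word_of_tape (until_blank_eq (r queryT).2).
by split=> //= k; case: (O _) k => [|b w] [|k]; rewrite //= nth_nil.
Qed.

Lemma runs_skip A : runs skip_chart A 1 A.
Proof.
by move=> ts r; exists 1, ts; split=> //; exact: stepsS (steps0 _).
Qed.

Lemma runs_seq F G A A' A'' b b' :
  runs F A b A' -> runs G A' b' A'' -> runs (F ;; G)%chart A (b + b') A''.
Proof.
move=> rF rG ts /rF[k [ts1 [kb s1 /rG[k' [ts2 [kb' s2 r2]]]]]].
exists (k + k'), ts2; split=> //; first exact: leq_add.
apply: (@steps_trans (F ;; G)%chart _ _ _ (Some (inr (entry G)), ts1)).
- exact: (@steps_sim _ (F ;; G)%chart
    (fun o => Some (if o is Some q' then inl q' else inr (entry G))) inl _ _ _ _ _ s1).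
- exact: (@steps_sim _ (F ;; G)%chart (omap inr) inr _ _ _ _ _ s2).
Qed.

Lemma scanned_head ts A (i : 'I_6) :
  represents ts A -> scanned (ts i) = head None (nth blank A i).2.
Proof. by case/(_ i) => _ /(_ 0) /=; rewrite nth0. Qed.

Lemma runs_branch (i : 'I_6) t F G A b A' :
  runs (if t (head None (nth blank A i).2) then F else G) A b A' ->
  runs (branch_chart i t F G) A b.+1 A'.
Proof.
move=> H ts r; move: (H ts r); rewrite -(scanned_head i r) => -[k [ts' [kb s r']]].
exists k.+1, ts'; split=> //; apply: stepsS => /=; move: kb s.
case: (t _) => _ s.
- exact: (@steps_sim _ (branch_chart i t F G) (omap (Some \o inl)) (Some \o inl)
           _ _ _ _ _ s).
- exact: (@steps_sim _ (branch_chart i t F G) (omap (Some \o inr)) (Some \o inr)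
           _ _ _ _ _ s).
Qed.

Lemma runs_while_false (i : 'I_6) t F A :
  t (head None (nth blank A i).2) = false -> runs (while_chart i t F) A 1 A.
Proof.
move=> H ts r; exists 1, ts; split=> //; apply: stepsS => /=.
by rewrite (scanned_head i r) H; exact: steps0.
Qed.

Lemma runs_while_true (i : 'I_6) (t : cell -> bool) F A A' A'' b b' :
  t (head None (nth blank A i).2) ->
  runs F A b A' -> runs (while_chart i t F) A' b' A'' ->
  runs (while_chart i t F) A (b + b').+1 A''.
Proof.
move=> H rF rW ts r; case: (rF ts r) => k [ts1 [kb s1 /rW[k' [ts2 [kb' s2 r2]]]]].
exists (k + k').+1, ts2; split=> //; first exact: leq_add.
apply: stepsS => /=; rewrite (scanned_head i r) H.
apply: steps_trans s2.
exact: (@steps_sim _ (while_chart i t F) Some Some _ _ _ _ _ s1).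
Qed.

(** The loop invariant is a sequence of states, [S j] being the one after [j] rounds. Each round
    pays for its test, and one more test ends the loop. *)
Lemma runs_for (i : 'I_6) (t : cell -> bool) F (S : nat -> seq atape) k b :
  (forall j, j < k ->
     t (head None (nth blank (S j) i).2) /\ runs F (S j) b (S j.+1)) ->
  t (head None (nth blank (S k) i).2) = false ->
  runs (while_chart i t F) (S 0) (k * b.+1).+1 (S k).
Proof.
elim: k S => [|k IH] S H e; first exact: runs_while_false.
have [H0 r0] := H 0 isT.
apply: runs_le (runs_while_true H0 r0 (IH (S \o succn) _ e)) _ => [j jk|].
  exact: H.
by rewrite mulSn addSn addnS.
Qed.

(* The tape that contains just w, with the head on the letter number k. *)
Definition at_pos (w : word) (k : nat) : atape :=
  (map Some (rev (take k w)), map Some (drop k w)).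

Lemma head_at_pos w k :
  head None (at_pos w k).2 = if k < size w then Some (nth false w k) else None.
Proof.
rewrite -nth0 /=; case: ltnP => h; last by rewrite drop_oversize.
by rewrite (nth_map false) ?size_drop ?subn_gt0 // nth_drop addn0.
Qed.

Lemma at_pos_eq w k k' : size w <= k -> size w <= k' -> at_pos w k = at_pos w k'.
Proof. by move=> h h'; rewrite /at_pos !take_oversize ?drop_oversize. Qed.

(** * Tests and elementary moves on a tape that holds one word *)

Definition is_bit (b : bool) (c : cell) := c == Some b.

Lemma isSome_at_pos w k : isSome (head None (at_pos w k).2) = (k < size w).
Proof. by rewrite head_at_pos; case: ifP. Qed.

Lemma is_true_at_pos w k : is_bit true (head None (at_pos w k).2) = nth false w k.
Proof.
rewrite head_at_pos /is_bit; case: ltnP => h; last by rewrite nth_default.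
by case: nth.
Qed.

Lemma is_false_at_pos w k :
  is_bit false (head None (at_pos w k).2) = ~~ nth true w k.
Proof.
rewrite head_at_pos /is_bit; case: ltnP => h; last by rewrite nth_default.
by rewrite (set_nth_default true) //; case: nth.
Qed.

(** The head stays put on a blank. Since [at_pos] does not distinguish positions past the end, the
    step from [k] to [k.+1] then holds for every [k]. *)
Definition right i :=
  branch_chart i isSome (do_chart i id MoveR) skip_chart.
Definition left i := do_chart i id MoveL.
Definition append i b := do_chart i (fun _ => Some b) MoveR.
Definition erase i := do_chart i (fun _ => None) MoveR.
(** The first move leaves the blank on which the head may stand after the word. The loop stops on
    the blank before the word, one cell too far, whence the last move. *)
Definition rewind i :=
  (left i ;; while_chart i isSome (left i) ;; do_chart i id MoveR)%chart.

Lemma runs_right (i : 'I_6) A w k :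
  nth blank A i = at_pos w k ->
  runs (right i) A 2 (set_nth blank A i (at_pos w k.+1)).
Proof.
move=> e; apply: runs_branch; rewrite e isSome_at_pos.
case: ltnP => h.
  apply: runs_eq (@runs_do i id MoveR A) _ => j; rewrite e /=.
  rewrite !nth_set_nth /=; case: eqP => // _.
  by rewrite /at_pos (take_nth false h) rev_rcons (drop_nth false h).
apply: (runs_eq (@runs_skip A)) => j; rewrite nth_set_nth /=.
by case: eqP => // ->; rewrite e (@at_pos_eq w k.+1 k) // leqW.
Qed.

Lemma runs_left (i : 'I_6) A w k :
  nth blank A i = at_pos w k.+1 -> k < size w ->
  runs (left i) A 1 (set_nth blank A i (at_pos w k)).
Proof.
move=> e h; apply: runs_set (@runs_do i id MoveL A) _; rewrite e /=.
rewrite /at_pos (take_nth false h) rev_rcons [drop k w](drop_nth false h) /=.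
split=> //= -[//|[|j]] /=; first by case: (drop k.+1 w).
by rewrite nth_behead.
Qed.

Lemma runs_append (i : 'I_6) b A w k :
  nth blank A i = at_pos w k -> size w <= k ->
  runs (append i b) A 1 (set_nth blank A i (at_pos (rcons w b) k.+1)).
Proof.
move=> e h; apply: runs_set (@runs_do i (fun _ => Some b) MoveR A) _.
rewrite e /at_pos !take_oversize ?drop_oversize ?size_rcons //.
by rewrite rev_rcons.
Qed.

(** The erased cell turns into a trailing blank on the left, which abstract tapes ignore. *)
Lemma runs_erase (i : 'I_6) A w :
  nth blank A i = at_pos w 0 ->
  runs (erase i) A 1 (set_nth blank A i (at_pos (behead w) 0)).
Proof.
move=> e; apply: runs_set (@runs_do i (fun _ => None) MoveR A) _; rewrite e /=.
rewrite /at_pos !take0 !drop0; split=> [[|[|k]]|k] //=.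
by rewrite behead_map.
Qed.

(** [l] lists the letters still to be passed, nearest first and starting with the scanned one; it is
    empty once the blank before the word is reached. *)
Lemma runs_rewind_loop (i : 'I_6) (l : word) r A :
  nth blank A i = (behead (map Some l), head None (map Some l) :: r) ->
  runs (while_chart i isSome (left i)) A (2 * size l).+1
    (set_nth blank A i ([::], None :: catrev (map Some l) r)).
Proof.
elim: l r A => [|b l IH] r A e.
  have H : runs (while_chart i isSome (left i)) A 1 A.
    by apply: runs_while_false; rewrite e.
  by apply: (runs_eq (runs_le H _)) => // j; rewrite nth_set_nth /=; case: eqP => // ->; rewrite e.
have := @runs_do i id MoveL A; rewrite e /= => H.
apply: runs_le; first apply: runs_while_true H _; first by rewrite e.
  apply: runs_eq; first apply: (IH (Some b :: r)).
    by rewrite nth_set_nth /= eqxx.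
  move=> j; rewrite nth_set_nth [X in atape_eq _ X]nth_set_nth /=.
  by case: (altP eqP) => // h; rewrite nth_set_nth /= (negPf h).
by rewrite mulnS.
Qed.

Lemma runs_rewind (i : 'I_6) A w k :
  nth blank A i = at_pos w k ->
  runs (rewind i) A (2 * size w + 4) (set_nth blank A i (at_pos w 0)).
Proof.
move=> e; set l := rev (take k w).
have := @runs_do i id MoveL A; rewrite e /= -/l => H.
apply: runs_le; first apply: runs_seq H _.
  apply: runs_seq.
    apply: (@runs_rewind_loop i l (head None (map Some (drop k w))
      :: behead (map Some (drop k w)))).
    by rewrite nth_set_nth /= eqxx.
  apply: runs_eq; first exact: runs_do.
  move=> j; rewrite nth_set_nth [X in atape_eq _ X]nth_set_nth /=.
  case: (altP eqP) => [_|h]; last by rewrite !(nth_set_nth, negPf h) /= (negPf h) nth_set_nth /= (negPf h).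
  rewrite nth_set_nth /= eqxx /at_pos /= take0 drop0; split=> /= [[|[]] //|j'].
  have -> : catrev (map Some l) (head None (map Some (drop k w)) ::
     behead (map Some (drop k w))) =
     map Some (take k w) ++ (head None (map Some (drop k w)) ::
     behead (map Some (drop k w))).
    by rewrite catrevE -map_rev /l revK.
  rewrite -[in RHS](cat_take_drop k w) map_cat !nth_cat; case: ifP => // _.
  by case: (drop k w) => [|//]; case: (_ - _) => // -[].
have : size l <= size w by rewrite size_rev size_take; case: ifP => // /ltnW.
by move=> *; lia.
Qed.

Lemma until_blank_some w : until_blank (map Some w) = w.
Proof. by elim: w => //= b w ->. Qed.

Lemma runs_query A w k :
  nth blank A queryT = at_pos w k ->
  runs ask_chart A 1 (set_nth blank A queryT (at_pos (O (drop k w)) 0)).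
Proof.
move=> e; have := @runs_ask A; rewrite e /= until_blank_some.
by rewrite /at_pos take0 drop0.
Qed.

Lemma outputs_of_runs F x b A y :
  runs F [:: at_pos x 0; blank; blank; blank; blank; blank] b A ->
  nth blank A outT = at_pos y 0 ->
  exists2 t, t <= b & outputs_within (machine_of F) O x t y.
Proof.
move=> H e; have [|k [ts' [kb /steps_machine sk r]]] := H (init (machine_of F) x).2.
  move=> i; rewrite ffunE /=; case: (altP (i =P inT)) => [->|].
    by rewrite /at_pos take0 drop0; split=> // -[|k]; case: x H => //= *; rewrite nth_nil.
  by case: i => -[|[|[|[|[|[|?]]]]]] //= ? _; split=> // -[|k]; rewrite //= nth_nil.
exists k => //; rewrite /outputs_within.
have -> : init (machine_of F) x = (Some (entry F), (init (machine_of F) x).2) by [].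
rewrite sk; split=> //; have [_] := r outT; rewrite e => {}e.
by rewrite /word_of_tape (until_blank_eq e) /= drop0 until_blank_some.
Qed.

End Execution.

(** * Arrangements and linear trees of an enumeration *)

Definition position_of (V : finType) (s : seq V) : {ffun V -> nat} :=
  [ffun v => (index v s).+1].

(** This counts the prefixes of length at least 2 that contain place [i]. Places 0 and 1 lie in all
    of them, whence the [maxn]. *)
Lemma sum_ltn i n : i < n -> \sum_(2 <= k < n.+1) (i < k) = n - maxn 1 i.
Proof.
move=> iV; case: (leqP i 1) => i1.
  rewrite (eq_big_nat _ _ (F2 := fun _ => 1)) => [|k /andP[k2 _]].
    by rewrite sum_nat_const_nat muln1; lia.
  by rewrite (leq_ltn_trans i1 k2).
rewrite (big_cat_nat (n := i.+1)) /=; [|exact: ltnW|exact: leqW].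
rewrite big_nat big1 => [|k /andP[_]]; last by rewrite ltnS ltnNge => ->.
rewrite (eq_big_nat _ _ (F2 := fun _ => 1)) => [|k /andP[-> //]].
by rewrite sum_nat_const_nat muln1; lia.
Qed.

(* The window of width n that starts at j shows the first [n - j] places if
   [j < n], and then the places other than the first, one at a time. *)
Definition window_word n := nseq n true ++ nseq n.-1 false ++ [:: true].

Lemma nth_window_prefix n i j :
  i < n -> j < n -> nth false (window_word n) (j + i) = (i < n - j).
Proof.
move=> iV jV; rewrite nth_cat size_nseq; case: ltnP => h.
  by rewrite nth_nseq h; apply/esym; lia.
rewrite nth_cat size_nseq ifT ?nth_nseq; last by lia.
by rewrite if_same; apply/esym/negbTE; lia.
Qed.

(** Past the first block, the only [true] is letter number [2n - 1]. The window starts where place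
    [k] hits it; smaller places fall into the block of [false], larger ones off the word, where the
    default is [false]. *)
Lemma nth_window_single n i k : i < n -> k < n -> 0 < k ->
  nth false (window_word n) (n + (n.-1 - k) + i) = (i == k).
Proof.
move=> iV kV k0; rewrite nth_cat size_nseq ifF; last by lia.
rewrite nth_cat size_nseq nth_nseq if_same; case: ltnP => h.
  by apply/esym/eqP=> e; move: h; rewrite e; lia.
case: eqP h => [->|ne] h; first by rewrite (_ : _ - _ - _ = 0) //; lia.
case E : (_ - _ - _) => [|x] /=; first by lia.
by rewrite nth_nil.
Qed.

(** * The clusters of the linear tree of an enumeration *)

Section Enumeration.
Variables (V : finType) (s : #|V|.-tuple V).
Hypothesis s_uniq : uniq s.

Lemma mem_enumeration v : v \in s.
Proof.
have e : #|s| = #|V| by rewrite (card_uniqP s_uniq) size_tuple.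
by have /subset_cardP/(_ (subset_predT _))-> : #|s| = #|predT : {pred V}| by rewrite e.
Qed.

Lemma index_enumeration v : index v s < #|V|.
Proof. by rewrite -[X in _ < X](size_tuple s) index_mem mem_enumeration. Qed.

Lemma index_enumeration_inj u v : index u s = index v s -> u = v.
Proof.
by move=> e; rewrite -(nth_index u (mem_enumeration u)) e nth_index ?mem_enumeration.
Qed.

Lemma in_prefix k v : (v \in [set v in take k s]) = (index v s < k).
Proof. by rewrite inE in_take ?mem_enumeration. Qed.

Lemma card_prefix k : k <= #|V| -> #|[set v in take k s]| = k.
Proof.
move=> kn; rewrite cardsE (card_uniqP (take_uniq _ s_uniq)).
by rewrite size_takel ?size_tuple.
Qed.

Lemma position_of_arrangement : arrangement (position_of s).
Proof.
split=> [v|u v|i /andP[i0 iV]]; rewrite ?ffunE.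
- exact: index_enumeration.
- by case=> /index_enumeration_inj.
- have : i.-1 < size s by rewrite size_tuple; lia.
  case E : (s : seq V) => [//|v0 s']; rewrite -E => h.
  by exists (nth v0 s i.-1); rewrite ffunE index_uniq // prednK.
Qed.

(** Cardinalities tell the prefixes from the singletons and from each other, so no cluster is summed
    twice. The cost, the number of clusters and the clusters through a vertex are all instances. *)
Lemma big_linear_tree (F : {set V} -> nat) :
  \sum_(X in linear_tree_of s) F X =
  \sum_v F [set v] + \sum_(2 <= k < #|V|.+1) F [set v in take k s].
Proof.
pose A := [set [set v] | v in s].
pose B := [set [set v in take k s] | k : 'I_#|V|.+1 & 2 <= k].
have dAB : [disjoint A & B].
  apply/pred0P=> X /=; apply/negP=> /andP[/imsetP[v _ ->] /imsetP[k]].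
  rewrite inE => k2 /(congr1 (fun X : {set V} => #|X|)).
  by rewrite cards1 card_prefix -1?ltnS // => e; rewrite -e in k2.
rewrite /linear_tree_of -/A -/B.
rewrite (eq_bigl (mem [predU A & B])) => [|X]; last by rewrite !inE.
rewrite bigU //=; congr (_ + _).
  rewrite big_imset /=; last by move=> u v _ _; exact: set1_inj.
  by apply: eq_bigl => v; rewrite mem_enumeration.
rewrite big_imset /= => [|k l _ _ /(congr1 (fun X : {set V} => #|X|))]; last first.
  by rewrite !card_prefix -1?ltnS // => /val_inj.
rewrite big_geq_mkord.
by apply: eq_bigl => k; rewrite inE.
Qed.

Lemma card_linear_tree : 0 < #|V| -> #|linear_tree_of s| = 2 * #|V| - 1.
Proof.
move=> V0; rewrite -sum1_card big_linear_tree sum1_card sum_nat_const_nat.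
have -> : #|(fun _ : V => true)| = #|V| by exact: eq_card.
by rewrite muln1; lia.
Qed.

Lemma count_linear_tree v :
  \sum_(X in linear_tree_of s) (v \in X) = #|V|.+1 - maxn 1 (index v s).
Proof.
rewrite big_linear_tree.
have -> : \sum_u (v \in [set u]) = 1.
  rewrite (bigD1 v) //= set11 big1 // => u.
  by rewrite inE eq_sym => /negPf->.
under eq_bigr do rewrite in_prefix.
have iV := index_enumeration v.
by rewrite (sum_ltn iV) subSn // geq_max (leq_ltn_trans _ iV) // ltnW.
Qed.

Definition window_cluster j : {set V} :=
  [set v | nth false (window_word #|V|) (j + index v s)].

Lemma window_prefix j :
  j < #|V| -> window_cluster j = [set v in take (#|V| - j) s].
Proof.
move=> jV; apply/setP=> v.
by rewrite in_prefix inE nth_window_prefix ?index_enumeration.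
Qed.

Lemma window_single v :
  0 < index v s -> window_cluster (#|V| + (#|V|.-1 - index v s)) = [set v].
Proof.
move=> v0; apply/setP=> u; rewrite !inE nth_window_single ?index_enumeration //.
by apply/eqP/eqP => [/index_enumeration_inj|->].
Qed.

Lemma prefix1 v : index v s = 0 -> [set v in take 1 s] = [set v].
Proof.
move=> v0; apply/setP=> u; rewrite in_prefix inE; apply/idP/eqP => [|->].
  by rewrite ltnS leqn0 => /eqP u0; apply: index_enumeration_inj; rewrite u0.
by rewrite v0.
Qed.

Lemma mem_windows :
  [seq window_cluster j | j <- iota 0 (2 * #|V| - 1)] =i linear_tree_of s.
Proof.
move=> X; apply/mapP/idP => [[j]|].
  rewrite mem_iota => /andP[_ jV] ->; have V0 : 0 < #|V| by lia.
  have nth_v i : i < #|V| -> exists2 v, index v s = i & v \in s.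
    move=> iV; have := position_of_arrangement => -[_ _ /(_ i.+1)].
    case=> [|v]; first by rewrite iV.
    by rewrite ffunE => -[<-]; exists v; rewrite ?mem_enumeration.
  case: (ltnP j #|V|) => h; last first.
    (* Past the prefixes, the windows isolate the vertices from the last one down to the second. *)
    have [|v vi vs] := nth_v (2 * #|V| - 1 - j); first by lia.
    have -> : j = #|V| + (#|V|.-1 - index v s) by rewrite vi; lia.
    rewrite window_single ?vi; last by lia.
    by rewrite inE imset_f.
  rewrite window_prefix //; case: (leqP 2 (#|V| - j)) => h2.
    have kV : #|V| - j < #|V|.+1 by lia.
    rewrite inE; apply/orP; right.
    by apply/imsetP; exists (Ordinal kV); rewrite ?inE.
  have [v vi vs] := nth_v 0 V0.
  rewrite (_ : _ - _ = 1); last by lia.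
  by rewrite (prefix1 vi) inE imset_f.
rewrite inE => /orP[/imsetP[v _ ->]|/imsetP[k]].
  have vV := index_enumeration v.
  (* The singleton of the first vertex is the prefix of length 1; the other singletons have windows
     of their own. *)
  have [v0|v0] := posnP (index v s).
    exists #|V|.-1; first by rewrite mem_iota; lia.
    rewrite window_prefix; last by lia.
    by rewrite (_ : _ - _ = 1) ?(prefix1 v0) //; lia.
  exists (#|V| + (#|V|.-1 - index v s)); first by rewrite mem_iota; lia.
  by rewrite window_single.
rewrite inE => k2 ->; have := ltn_ord k; rewrite ltnS => kV.
exists (#|V| - k); first by rewrite mem_iota; lia.
by rewrite window_prefix ?subKn //; lia.
Qed.

(** The windows cover all clusters and are exactly as many, so none is repeated. *)
Lemma uniq_windows :
  0 < #|V| -> uniq [seq window_cluster j | j <- iota 0 (2 * #|V| - 1)].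
Proof.
move=> V0; apply/card_uniqP.
by rewrite (eq_card mem_windows) card_linear_tree // size_map size_iota.
Qed.

End Enumeration.

Lemma arrangement_position_of (V : finType) (phi : {ffun V -> nat}) :
  arrangement phi ->
  exists2 s : #|V|.-tuple V, uniq s & phi = position_of s.
Proof.
case=> phiV phi_inj phi_surj.
have ex (i : 'I_#|V|) : exists v, phi v == i.+1.
  by have [|v e] := phi_surj i.+1; [rewrite /= ltn_ord | exists v; apply/eqP].
pose f i := xchoose (ex i).
have fP i : phi (f i) = i.+1 by apply/eqP/(xchooseP (ex i)).
have f_inj : injective f.
  by move=> i j e; apply: val_inj; have := fP i; rewrite e fP => -[/esym].
exists (mktuple f); first by rewrite map_inj_uniq ?enum_uniq.
apply/ffunP=> v; rewrite ffunE.
have iV : (phi v).-1 < #|V| by have := phiV v; lia.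
have -> : v = f (Ordinal iV).
  by apply: phi_inj; rewrite fP /= prednK //; have := phiV v; lia.
by rewrite fP /= index_map // index_enum_ord.
Qed.

(** * Costs, anchors and optimality on both sides *)

Section Anchored.
Variables (V : finType) (G : sgraph V) (w : V).
Implicit Types s : #|V|.-tuple V.

(** Both sides consist of the prefixes of length at least 2, all singletons, and [vdeg G w], which
    the arrangement contributes as its prefix of length 1. The additive form avoids truncated
    subtraction. *)
Lemma beta_position_of s : uniq s -> index w s = 0 ->
  beta_arrangement G (position_of s) + \sum_v vdeg G v =
  beta_reassembling G (linear_tree_of s) + vdeg G w.
Proof.
move=> s_uniq w0; have V0 := index_enumeration s_uniq w.
have E i : [set v | position_of s v <= i] = [set v in take i s].
  by apply/setP=> v; rewrite in_prefix // inE ffunE.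
rewrite /beta_reassembling big_linear_tree // /beta_arrangement.
under eq_bigr do rewrite E.
rewrite big_ltn; last by lia.
by rewrite (prefix1 s_uniq w0) /vdeg; lia.
Qed.

Lemma anchored_position_of s : uniq s ->
  arrangement_anchored G w (position_of s) ->
  reassembling_anchored G w (linear_tree_of s).
Proof.
move=> s_uniq [+ [w']]; rewrite !ffunE => -[w0] [w1] degw; exists w' => //.
have w2 : 2 < #|V|.+1 by have := index_enumeration s_uniq w'; rewrite w1.
have E : [set w; w'] = [set v in take 2 s].
  apply/setP=> v; rewrite in_prefix // !inE.
  apply/orP/idP => [[/eqP->|/eqP->]|]; rewrite ?w0 ?w1 //.
  case E : (index v s) => [|[|//]] _; [left|right]; apply/eqP;
    by apply: (index_enumeration_inj s_uniq); rewrite E.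
split.
- rewrite E inE; apply/orP; right.
  by apply/imsetP; exists (Ordinal w2); rewrite ?inE.
- by rewrite E card_prefix.
- move=> Y; rewrite inE => /orP[/imsetP[v _ ->]|/imsetP[k]]; first by rewrite cards1.
  rewrite inE E => k2 -> _; apply/subsetP=> v; rewrite !in_prefix // => /leq_trans.
  exact.
Qed.

(* A linear tree does not determine the order of its first two vertices. *)
Lemma anchored_linear_tree s : uniq s ->
  reassembling_anchored G w (linear_tree_of s) ->
  exists s', [/\ uniq s', linear_tree_of s' = linear_tree_of s
                & arrangement_anchored G w (position_of s')].
Proof.
move=> s_uniq [w' [Xs X1 _] degw].
have ww : w != w' by apply: contra X1 => /eqP<-; rewrite setUid cards1.
have X2 : [set w; w'] = [set v in take 2 s] /\ 2 <= #|V|.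
  move: Xs; rewrite inE => /orP[/imsetP[v _ E]|]; first by rewrite E cards1 in X1.
  case/imsetP=> k; rewrite inE => k2 E; have kV : k <= #|V| by rewrite -ltnS.
  have := cards2 w w'; rewrite ww E card_prefix // => e.
  by split; [rewrite -e | exact: leq_trans kV].
case: X2 => X2 V2; case E : (s : seq V) => [|a [|b r]].
- by have := size_tuple s; rewrite E /= => e; rewrite -e in V2.
- by have := size_tuple s; rewrite E /= => e; rewrite -e in V2.
have E2 : [set w; w'] = [set a; b].
  by rewrite X2 E /= take0; apply/setP=> v; rewrite !inE.
have ab : a != b.
  by move: s_uniq; rewrite E /= inE negb_or => /andP[/andP[]].
have [[ea eb]|[ea eb]] : (a = w /\ b = w') \/ (a = w' /\ b = w).
  have := set21 a b; have := set22 a b; rewrite -E2 !inE.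
  case/orP=> /eqP eb /orP[] /eqP ea; rewrite ea eb ?eqxx in ab *; by [|left|right].
- exists s; split=> //; split; first by rewrite ffunE E ea /= eqxx.
  by exists w' => //; rewrite ffunE E ea eb /= (negPf ww) eqxx.
(* Here [w] comes second. Exchanging the first two vertices changes neither the singletons nor the
   prefixes of length at least 2. *)
have s'P : size [:: b, a & r] == #|V| by have := size_tuple s; rewrite E /= => ->.
exists (Tuple s'P); split.
- move: s_uniq; rewrite E /= !inE !negb_or => /andP[/andP[ne ->] /andP[-> ->]].
  by rewrite eq_sym ne.
- congr (_ :|: _).
    have mE v : (v \in Tuple s'P) = (v \in s) by rewrite !memtE /= E !inE orbCA.
    by apply/setP=> X; apply/imsetP/imsetP => -[v vs ->]; exists v; rewrite // ?mE // -mE.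
  apply: eq_in_imset => -[[|[|k]] kV]; rewrite inE //= => _.
  by apply/setP=> v; rewrite E /= !inE orbCA.
- split; first by rewrite ffunE /= eb eqxx.
  by exists w' => //; rewrite ffunE /= ea eb (negPf ww) eqxx.
Qed.

(** A competing tree is first given an enumeration that starts with [w]; then both costs differ from
    those of the arrangements by the same constant. *)
Lemma optimal_reassembling_of s : uniq s ->
  optimal_arrangement G w (position_of s) ->
  optimal_reassembling G w (linear_tree_of s).
Proof.
move=> s_uniq [_ anc opt]; split; [by exists s | exact: anchored_position_of |].
move=> _ [t t_uniq ->] /(anchored_linear_tree t_uniq)[t' [t'_uniq <- anc']].
have w0 u : arrangement_anchored G w (position_of u) -> index w u = 0.
  by case; rewrite ffunE => -[].
have := opt _ (position_of_arrangement t'_uniq) anc'.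
rewrite -(leq_add2r (\sum_v vdeg G v)) !beta_position_of ?w0 //.
by rewrite leq_add2r.
Qed.

Lemma optimal_arrangement_of s : uniq s ->
  arrangement_anchored G w (position_of s) ->
  optimal_reassembling G w (linear_tree_of s) ->
  optimal_arrangement G w (position_of s).
Proof.
move=> s_uniq anc [_ _ opt]; split=> //; first exact: position_of_arrangement.
move=> _ /arrangement_position_of[t t_uniq ->] anc'.
have w0 u : arrangement_anchored G w (position_of u) -> index w u = 0.
  by case; rewrite ffunE => -[].
have := opt _ (ex_intro2 _ _ t t_uniq erefl) (anchored_position_of t_uniq anc').
rewrite -(leq_add2r (vdeg G w)) -!beta_position_of ?w0 //.
by rewrite leq_add2r.
Qed.

(** This serves twice: to read an answer of the reassembling oracle, and to show that without an
    optimal arrangement there is no optimal reassembling. *)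
Lemma optimal_reassemblingE L : optimal_reassembling G w L ->
  exists s, [/\ uniq s, L = linear_tree_of s,
    arrangement_anchored G w (position_of s)
    & optimal_arrangement G w (position_of s)].
Proof.
move=> opt; have [[s s_uniq EL] anc _] := opt.
have [|s' [u' E anc']] := @anchored_linear_tree s s_uniq; first by rewrite -EL.
exists s'; split; rewrite ?E //.
by apply: optimal_arrangement_of => //; rewrite E -EL.
Qed.

(* The first two vertices lie in all clusters but singletons, so counting
   clusters gives position 2 to both of them. *)
Lemma position_of_count s v : uniq s ->
  arrangement_anchored G w (position_of s) ->
  position_of s v = if v == w then 1
    else #|V|.+2 - \sum_(X in linear_tree_of s) (v \in X).
Proof.
move=> s_uniq [w1 _]; case: eqP => [->//|ne].
have iV := index_enumeration s_uniq v.
rewrite count_linear_tree // ffunE.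
have : index v s != 0.
  apply: contra_notN ne => /eqP v0; apply: (index_enumeration_inj s_uniq).
  by move: w1; rewrite v0 ffunE => -[].
move: (index v s) iV => i iV; rewrite maxnE add1n; lia.
Qed.

End Anchored.

(** * The two reductions as programs *)

Local Open Scope chart_scope.

Lemma runs_cast O F A b A' A'' :
  runs O F A b A' -> A' = A'' -> runs O F A b A''.
Proof. by move=> + <-. Qed.

(** States are explicit lists of six tapes, so [nth] and [set_nth] compute. Only they and the tape
    numbers are unfolded, to keep words and positions intact; intermediate states are found by
    unification. *)
Ltac tape_cbn :=
  cbn [nth set_nth nat_of_ord inT queryT outT sizeT workT loopT].
Ltac run_one lem := eapply lem; tape_cbn; [reflexivity | ..].
Ltac run_last lem := eapply runs_cast; [run_one lem | tape_cbn; try reflexivity].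
Ltac run_step lem := eapply runs_seq; [run_one lem | tape_cbn].

Lemma rcons_nseq T n (x : T) : rcons (nseq n x) x = nseq n.+1 x.
Proof. by rewrite -cats1 -(nseqD n 1) addn1. Qed.

Definition copy_bit i j :=
  branch_chart i (is_bit true) (append j true) (append j false).

(** The whole input is copied to the query tape. Its unary header, read by the first loop, is also
    copied to [sizeT] as the ruler of length [n]. *)
Definition consult :=
  (while_chart inT (is_bit true)
     (append sizeT true ;; append queryT true ;; right inT) ;;
   while_chart inT isSome (copy_bit inT queryT ;; right inT) ;;
   rewind queryT ;;
   ask_chart)%chart.

Section Programs.
Variable O : word -> word.
Notation runs := (runs O).
Notation empty := (at_pos [::] 0).

Lemma runs_copy_bit (i j : 'I_6) A w k u l :
  nth blank A i = at_pos w k -> nth blank A j = at_pos u l -> size u <= l ->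
  runs (copy_bit i j) A 2 (set_nth blank A j (at_pos (rcons u (nth false w k)) l.+1)).
Proof.
move=> ei ej h; apply: runs_branch; rewrite ei is_true_at_pos.
by case: (nth false w k); apply: runs_append.
Qed.

Lemma runs_consult n y :
  let x := nseq n true ++ false :: y in
  runs consult [:: at_pos x 0; empty; empty; empty; empty; empty]
    (12 * size x + 20)
    [:: at_pos x (size x); at_pos (O x) 0; empty; at_pos (nseq n true) n; empty; empty].
Proof.
move=> x.
pose S1 j := [:: at_pos x j; at_pos (take j x) j; empty;
  at_pos (nseq j true) j; empty; empty].
pose S2 j := [:: at_pos x (n + j); at_pos (take (n + j) x) (n + j); empty;
  at_pos (nseq n true) n; empty; empty].
have nx : n < size x by rewrite size_cat size_nseq /=; lia.
have nth_x j : j < n -> nth false x j.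
  by move=> jn; rewrite nth_cat size_nseq jn nth_nseq jn.
have r1 : runs (while_chart inT (is_bit true)
    (append sizeT true ;; append queryT true ;; right inT)) (S1 0) (n * 5).+1 (S1 n).
  apply: runs_for => [j jn|]; tape_cbn; last first.
    by rewrite is_true_at_pos nth_cat size_nseq ltnn subnn.
  rewrite is_true_at_pos nth_x //; split=> //.
  rewrite /S1 (take_nth false) ?nth_x //; last exact: ltn_trans nx.
  have -> : nseq j.+1 true = rcons (nseq j true) true by rewrite rcons_nseq.
  apply: runs_le.
    run_step runs_append; first by rewrite size_nseq.
    run_step runs_append; first by rewrite size_takel //; lia.
    run_last runs_right.
  by [].
have r2 : runs (while_chart inT isSome (copy_bit inT queryT ;; right inT))
    (S2 0) ((size x - n) * 5).+1 (S2 (size x - n)).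
  apply: runs_for => [j jn|]; tape_cbn; last by rewrite isSome_at_pos; lia.
  rewrite isSome_at_pos; split; first by lia.
  rewrite /S2 addnS (take_nth false); last by lia.
  apply: runs_le.
    eapply runs_seq; first by
      eapply (@runs_copy_bit inT queryT); tape_cbn;
        [reflexivity | reflexivity | rewrite size_takel //; lia].
    tape_cbn; run_last runs_right.
  by [].
apply: runs_le.
  rewrite /S1 take0 in r1; rewrite /consult; apply: runs_seq r1 _.
  rewrite -[in take _ _](addn0 n) -[X in at_pos x X](addn0 n) -[X in at_pos (take _ _) X](addn0 n).
  apply: runs_seq r2 _; rewrite /S2 subnKC ?take_size; last exact: ltnW.
  run_step runs_rewind.
  by run_last runs_query; rewrite drop0.
lia.
Qed.

(** * From a list of clusters to vertex positions *)

Definition skip_row :=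
  rewind sizeT ;; while_chart sizeT isSome (right sizeT ;; right queryT).

Lemma runs_skip_row n i q k o c v :
  runs skip_row [:: i; at_pos q k; o; at_pos (nseq n true) n; c; v] (7 * n + 5)
    [:: i; at_pos q (k + n); o; at_pos (nseq n true) n; c; v].
Proof.
pose S j := [:: i; at_pos q (k + j); o; at_pos (nseq n true) j; c; v].
rewrite /skip_row; apply: runs_le.
  run_step runs_rewind.
  have := @runs_for O sizeT isSome (right sizeT ;; right queryT) S n 4.
  rewrite /S addn0; apply=> [j jn|]; tape_cbn; rewrite isSome_at_pos size_nseq.
    split=> //; rewrite addnS; apply: runs_le; first by run_step runs_right; run_last runs_right.
    by [].
  exact: ltnn.
by rewrite size_nseq; lia.
Qed.

(** The count is not written down: it is the position of the head of [workT]. Only the first column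
    is ever read, since the main loop erases one letter of the answer per vertex. *)
Definition count_column :=
  while_chart queryT isSome
    (branch_chart queryT (is_bit true) (right workT) skip_chart ;; skip_row).

(** The hypotheses force exactly [K] rounds. They allow a last row cut short by the letters erased
    at the front, where the head stops at the end of the word. *)
Lemma runs_count_column n K w i o c v :
  (forall j, j < K -> j * n < size w) -> size w <= K * n ->
  runs count_column
    [:: i; at_pos w 0; o; at_pos (nseq n true) n; at_pos c 0; v]
    (K * (7 * n + 9)).+1
    [:: i; at_pos w (K * n); o; at_pos (nseq n true) n;
        at_pos c (\sum_(j < K) nth false w (j * n)); v].
Proof.
move=> wK Kw.
pose S j := [:: i; at_pos w (j * n); o; at_pos (nseq n true) n;
        at_pos c (\sum_(l < j) nth false w (l * n)); v].
suff : runs count_column (S 0) (K * (7 * n + 9)).+1 (S K).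
  by rewrite /S mul0n big_ord0.
rewrite /count_column (addnS _ 8); apply: runs_for => [j jK|]; tape_cbn;
  rewrite isSome_at_pos.
  split; first exact: wK.
  rewrite /S (mulSnr j) big_ord_recr /=.
  apply: runs_le.
    eapply runs_seq; last exact: runs_skip_row.
    apply: (@runs_branch _ _ _ _ _ _ 2); tape_cbn; rewrite is_true_at_pos.
    case: (nth false w (j * n)) => /=.
      by rewrite addn1; run_last runs_right.
    by rewrite addn0; apply: runs_le (@runs_skip _ _) _.
  lia.
by rewrite ltnNge Kw.
Qed.

(** Subtraction comes for free: with [c] letters on [workT] and the head at [r], copying the rest
    writes [c - r] letters. The input head runs along the unary code of the anchor, whose closing
    [false] marks the turn of the anchor itself. *)
Definition emit_position :=
  branch_chart inT (is_bit false) (append outT true)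
    (while_chart workT isSome (append outT true ;; right workT)) ;;
  append outT false ;;
  rewind workT.

(** The default [true] in [nth true x k] reflects that the blank met by vertices after the anchor
    must not be taken for the closing [false]. *)
Lemma runs_emit_position x k q o s c r v :
  runs emit_position
    [:: at_pos x k; q; at_pos o (size o); s; at_pos (nseq c true) r; v]
    (6 * c + 8)
    (let o' := o ++ unary (if nth true x k then c - r else 1) in
     [:: at_pos x k; q; at_pos o' (size o'); s; at_pos (nseq c true) 0; v]).
Proof.
rewrite /emit_position; apply: (@runs_le _ _ _ ((c * 4 + 2) + (1 + (2 * c + 4)))); last by lia.
set z := if _ then _ else _.
(* The final position of the work head depends on the branch; the rewinding that follows forgets
   it. *)
suff [r' H] : exists r', runs (branch_chart inT (is_bit false) (append outT true)
      (while_chart workT isSome (append outT true ;; right workT)))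
    [:: at_pos x k; q; at_pos o (size o); s; at_pos (nseq c true) r; v]
    (c * 4 + 2)
    (let o' := o ++ nseq z true in
    [:: at_pos x k; q; at_pos o' (size o'); s; at_pos (nseq c true) r'; v]).
  apply: runs_seq H _; run_step runs_append; first by [].
  rewrite rcons_cat -/(unary z) (_ : (size _).+1 = size (o ++ unary z)); last first.
    by rewrite !size_cat size_rcons addnS.
  by apply: runs_le; [run_last runs_rewind | rewrite size_nseq].
exists (if nth true x k then r + z else r).
rewrite addn2; apply: runs_branch; tape_cbn; rewrite is_false_at_pos {}/z.
case: (nth true x k) => /=; last first.
  rewrite size_cat addn1 cats1.
  by apply: runs_le; first by run_last runs_append.
pose S j := [:: at_pos x k; q; at_pos (o ++ nseq j true) (size (o ++ nseq j true));
   s; at_pos (nseq c true) (r + j); v].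
apply: runs_le.
  suff : runs (while_chart workT isSome (append outT true ;; right workT)) (S 0)
      ((c - r) * 4).+1 (S (c - r)) by rewrite /S cats0 addn0; exact.
  apply: runs_for => [j jn|]; tape_cbn; rewrite isSome_at_pos size_nseq; last by lia.
  split; first by lia.
  rewrite /S addnS -rcons_nseq -rcons_cat size_rcons.
  by apply: runs_le; first by run_step runs_append; [|run_last runs_right].
by rewrite ltnS leq_mul2r leq_subr.
Qed.
Definition find_anchor :=
  left inT ;; left inT ;; while_chart inT (is_bit true) (left inT) ;; right inT.

Lemma runs_find_anchor z a A :
  let x := z ++ false :: unary a in
  nth blank A inT = at_pos x (size x) ->
  runs find_anchor A (2 * a + 5) (set_nth blank A inT (at_pos x (size z).+1)).
Proof.
move=> x.
have sx : size x = (size z + a).+2.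
  by rewrite size_cat /= size_rcons size_nseq; lia.
(* [A] is not empty: a missing tape would be blank, whereas here [x] lies to the left of the
   head. *)
case: A => [|i A] /=; first by move=> /(congr1 (size \o fst)); rewrite /= size_map size_rev take_size sx.
move=> ->; pose S j := at_pos x (size z + a - j) :: A.
have nth_x j : j <= a -> nth false x (size z + j) = (0 < j).
  move=> ja; rewrite nth_cat ltnNge leq_addr /= addKn; case: j ja => //= j ja.
  by rewrite nth_rcons size_nseq ja nth_nseq ja.
apply: runs_le.
  rewrite /find_anchor sx; run_step runs_left; first by lia.
  run_step runs_left; first by lia.
  eapply runs_seq.
    rewrite -(subn0 (size z + a)); apply: (@runs_for _ _ _ _ S a 1) => [j ja|].
      tape_cbn; rewrite is_true_at_pos -addnBA; last exact: ltnW.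
      rewrite nth_x ?leq_subr //; split; first by lia.
      rewrite /S (_ : _ - j = (size z + a - j.+1).+1); last by lia.
      by run_last runs_left; lia.
    by tape_cbn; rewrite is_true_at_pos addnK -[size z]addn0 nth_x.
  rewrite /S addnK.
  run_last runs_right.
lia.
Qed.

(** The letters from the head of [sizeT] on set the number of rounds. [loopT] records the total
    filled so far and later counts the rounds of the main loop. *)
Definition fill b :=
  while_chart sizeT isSome (append workT b ;; append loopT true ;; right sizeT).

Lemma runs_fill b n k i q o u m :
  k <= n ->
  runs (fill b)
    [:: i; q; o; at_pos (nseq n true) k; at_pos u (size u); at_pos (nseq m true) m]
    (n * 5).+1
    (let u' := u ++ nseq (n - k) b in
     [:: i; q; o; at_pos (nseq n true) n; at_pos u' (size u');
         at_pos (nseq (m + (n - k)) true) (m + (n - k))]).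
Proof.
move=> kn.
pose S j := let u' := u ++ nseq j b in
  [:: i; q; o; at_pos (nseq n true) (k + j); at_pos u' (size u');
      at_pos (nseq (m + j) true) (m + j)].
suff : runs (fill b) (S 0) ((n - k) * 5).+1 (S (n - k)).
  rewrite /S cats0 !addn0 subnKC // => H; apply: runs_le H _.
  by rewrite ltnS leq_mul2r leq_subr.
apply: runs_for => [j jn|]; tape_cbn; rewrite isSome_at_pos size_nseq; last by lia.
split; first by lia.
rewrite /S !addnS -rcons_nseq -rcons_cat size_rcons -rcons_nseq.
apply: runs_le.
  run_step runs_append; first by [].
  run_step runs_append; first by rewrite size_nseq.
  run_last runs_right.
by [].
Qed.

(** The two letters appended after [fill] turn the [n] letters on [workT] into the [n + 2] from
    which counts are subtracted. *)
Definition place_vertices :=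
  find_anchor ;;
  rewind sizeT ;; fill true ;; append workT true ;; append workT true ;;
  rewind workT ;; rewind loopT ;;
  while_chart loopT isSome
    (count_column ;; emit_position ;; right inT ;; rewind queryT ;;
     erase queryT ;; right loopT).

Definition column_count n K (s : word) i := \sum_(j < K) nth false s (i + j * n).

Definition placed n K (s : word) a i :=
  if i == a then 1 else n.+2 - column_count n K s i.

(** [m] will be the length of the input. Bounding all other sizes by it yields a single generous
    polynomial. *)
Lemma runs_place_vertices n K z a s m :
  let x := z ++ false :: unary a in
  size s = K * n -> n <= m -> a <= m -> K <= 2 * m ->
  exists i q w l,
  runs place_vertices
    [:: at_pos x (size x); at_pos s 0; at_pos [:: true] 1; at_pos (nseq n true) n;
        empty; empty]
    (50 * m + 60 + m * (2 * m * (7 * m + 9) + 4 * m * m + 20 * m + 60))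
    (let o := true :: flatten [seq unary (placed n K s a i) | i <- iota 0 n] in
     [:: i; q; at_pos o (size o); at_pos (nseq n true) n; w; l]).
Proof.
move=> x sK nm am Km.
pose out i := true :: flatten [seq unary (placed n K s a i) | i <- iota 0 i].
(* After [i] vertices, [i] letters of the answer are erased and the input head is [i] letters into
   the code of the anchor. *)
pose S i := [:: at_pos x ((size z).+1 + i); at_pos (drop i s) 0;
  at_pos (out i) (size (out i)); at_pos (nseq n true) n;
  at_pos (nseq n.+2 true) 0; at_pos (nseq n true) i].
exists (at_pos x ((size z).+1 + n)), (at_pos (drop n s) 0),
  (at_pos (nseq n.+2 true) 0), (at_pos (nseq n true) n).
have nth_x j : nth true x ((size z).+1 + j) = (j != a).
  rewrite nth_cat addSnnS ltnNge leq_addr addKn /= nth_rcons size_nseq nth_nseq.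
  by case: ltngtP.
pose T := 2 * m * (7 * m + 9) + 4 * m * m + 20 * m + 50.
have loop : runs (while_chart loopT isSome
    (count_column ;; emit_position ;; right inT ;; rewind queryT ;;
     erase queryT ;; right loopT)) (S 0) (n * T.+1).+1 (S n).
  apply: runs_for => [i im|]; tape_cbn; rewrite isSome_at_pos size_nseq ?ltnn //.
  split=> //.
  apply: runs_le.
    eapply runs_seq; first apply: (@runs_count_column n K).
    - move=> j jK; rewrite size_drop sK ltn_subRL.
      have : j.+1 * n <= K * n by rewrite leq_mul2r jK orbT.
      by rewrite mulSn; lia.
    - by rewrite size_drop sK leq_subr.
    eapply runs_seq; first exact: runs_emit_position.
    tape_cbn; run_step runs_right.
    run_step runs_rewind.
    run_step runs_erase.
    run_last runs_right.
    rewrite /S -[behead _]drop1 drop_drop add1n nth_x addnS.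
    suff -> : out i ++ unary (if i != a then n.+2 - \sum_(j < K) nth false (drop i s) (j * n)
      else 1) = out i.+1 by [].
    rewrite /out -[in iota 0 i.+1]addn1 iotaD map_cat flatten_cat /= !cats0.
    rewrite /placed /column_count; case: eqP => //= _.
    by congr (_ :: _ ++ unary (_ - _)); apply: eq_bigr => j _; rewrite nth_drop.
  have h1 : K * (7 * n + 9) <= 2 * m * (7 * m + 9) by apply: leq_mul => //; lia.
  have h2 : 2 * size (drop i s) <= 4 * m * m.
    rewrite size_drop sK; have : K * n <= 2 * m * m by exact: leq_mul.
    by lia.
  by rewrite /T; lia.
apply: runs_le.
  rewrite /place_vertices; eapply runs_seq; first exact: runs_find_anchor.
  tape_cbn; run_step runs_rewind.
  eapply runs_seq; first exact: (@runs_fill true n 0 _ _ _ [::] 0).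
  rewrite subn0 add0n; tape_cbn; run_step runs_append; first by [].
  run_step runs_append; first by rewrite size_rcons.
  run_step runs_rewind; run_step runs_rewind.
  move: loop; rewrite /S addn0 drop0 (_ : out 0 = [:: true]) // -!rcons_nseq; exact.
rewrite !size_rcons !size_nseq.
have : n * T.+1 <= m * T.+1 by rewrite leq_mul2r nm orbT.
have : m * T.+1 <= m * (2 * m * (7 * m + 9) + 4 * m * m + 20 * m + 60).
  by rewrite leq_mul2l /T; apply/orP; right; lia.
by lia.
Qed.

(** * From vertex positions to a list of clusters *)

(** The first letter of each unary position is skipped, so the work head advances by the position
    minus 1, the offset of the vertex in the window. *)
Definition emit_row :=
  while_chart queryT isSome
    (right queryT ;;
     while_chart queryT (is_bit true) (right queryT ;; right workT) ;;
     copy_bit workT outT ;; right queryT ;; rewind workT).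

(** [pre] holds the numbers already read, which lets the induction on [fs] keep the word on the
    query tape fixed. An offset past the end of [K] meets a blank, copied as [false] in accordance
    with the default. *)
Lemma runs_emit_row n fs pre K i o c l :
  all (fun f => 0 < f <= n) fs ->
  let s := pre ++ flatten (map unary fs) in
  runs emit_row
    [:: i; at_pos s (size pre); at_pos o (size o); c; at_pos K 0; l]
    (size fs * (5 * n + 2 * size K + 12)).+1
    (let o' := o ++ [seq nth false K f.-1 | f <- fs] in
     [:: i; at_pos s (size s); at_pos o' (size o'); c; at_pos K 0; l]).
Proof.
elim: fs pre o => [|f fs IH] pre o /=.
  rewrite !cats0 => _; apply: runs_while_false; tape_cbn.
  by rewrite isSome_at_pos ltnn.
case/andP=> /andP[f0 fn] /IH {}IH.
have := IH (pre ++ unary f) (rcons o (nth false K f.-1)).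
rewrite cat_rcons -catA; set s := pre ++ _ => {}IH.
have nth_s j : j <= f -> nth false s (size pre + j) = (j < f).
  move=> jf; rewrite nth_cat ltnNge leq_addr /= addKn nth_cat size_rcons size_nseq.
  rewrite ltnS jf nth_rcons size_nseq nth_nseq.
  by case: ltngtP jf.
apply: runs_le.
  apply: runs_while_true; last exact: IH.
    tape_cbn; rewrite isSome_at_pos size_cat size_cat size_rcons size_nseq; lia.
  run_step runs_right.
  pose S j := [:: i; at_pos s ((size pre).+1 + j); at_pos o (size o); c; at_pos K j; l].
  eapply runs_seq.
    rewrite -[X in at_pos s X]addn0.
    apply: (@runs_for _ _ _ _ S f.-1 4) => [j ja|].
      tape_cbn; rewrite is_true_at_pos addSnnS nth_s; last by lia.
      split; first by lia.
      rewrite /S addnS; apply: runs_le; first by run_step runs_right; run_last runs_right.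
      by [].
    by tape_cbn; rewrite is_true_at_pos addSnnS nth_s prednK ?ltnn.
  eapply runs_seq; first by
    eapply (@runs_copy_bit workT outT); tape_cbn; [reflexivity | reflexivity |].
  tape_cbn; run_step runs_right.
  run_last runs_rewind.
  by rewrite size_cat !size_rcons size_nseq addSnnS prednK // addnS.
have : f.-1 * 5 <= 5 * n by rewrite mulnC leq_mul2l; lia.
by rewrite mulSn; lia.
Qed.

(** The second [fill] starts one letter into the ruler and adds [n - 1] letters; both together leave
    [2n - 1], the number of clusters, on [loopT]. Erasing the first letter of [workT] slides the
    window. *)
Definition list_windows :=
  rewind sizeT ;; fill true ;; rewind sizeT ;; right sizeT ;; fill false ;;
  append workT true ;; rewind workT ;; rewind loopT ;;
  while_chart loopT isSome
    (emit_row ;; rewind queryT ;; erase workT ;; right loopT).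

Lemma runs_list_windows n fs m i :
  all (fun f => 0 < f <= n) fs -> size fs = n -> 0 < n -> n <= m ->
  exists q w l,
  runs list_windows
    [:: i; at_pos (flatten (map unary fs)) 0; at_pos [:: true] 1;
        at_pos (nseq n true) n; empty; empty]
    (50 * m + 60 + 2 * m * (m * (9 * m + 12) + 2 * m * m + 2 * m + 20))
    (let o := true :: flatten [seq [seq nth false (window_word n) (j + f.-1) | f <- fs]
                              | j <- iota 0 (2 * n - 1)] in
     [:: i; q; at_pos o (size o); at_pos (nseq n true) n; w; l]).
Proof.
move=> fsn sfs n0 nm; set s := flatten _; set K := 2 * n - 1.
pose out i := true :: flatten
  [seq [seq nth false (window_word n) (j + f.-1) | f <- fs] | j <- iota 0 i].
pose S j := [:: i; at_pos s 0; at_pos (out j) (size (out j)); at_pos (nseq n true) n;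
  at_pos (drop j (window_word n)) 0; at_pos (nseq K true) j].
exists (at_pos s 0), (at_pos (drop K (window_word n)) 0), (at_pos (nseq K true) K).
have sw : size (window_word n) = 2 * n.
  by rewrite !size_cat !size_nseq /=; lia.
have ss : size s <= m * m.+1.
  have : size s <= size fs * n.+1.
    rewrite /s; elim: (fs) fsn => //= f l IH /andP[/andP[_ fn] /IH].
    by rewrite size_cat size_rcons size_nseq mulSn; lia.
  by move/leq_trans; apply; rewrite sfs; apply: leq_mul.
pose T := m * (9 * m + 12) + 2 * m * m + 2 * m + 10.
have loop : runs (while_chart loopT isSome
    (emit_row ;; rewind queryT ;; erase workT ;; right loopT)) (S 0) (K * T.+1).+1 (S K).
  apply: runs_for => [j jK|]; tape_cbn; rewrite isSome_at_pos size_nseq ?ltnn //.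
  split=> //.
  apply: runs_le.
    eapply runs_seq; first apply: (@runs_emit_row n fs [::]) => //.
    tape_cbn; run_step runs_rewind.
    run_step runs_erase.
    run_last runs_right.
    rewrite /S -[behead _]drop1 drop_drop add1n.
    suff -> : out j ++ [seq nth false (drop j (window_word n)) f.-1 | f <- fs] = out j.+1.
      by [].
    rewrite /out -[in iota 0 j.+1]addn1 iotaD map_cat flatten_cat /= !cats0.
    by congr (_ :: _ ++ _); apply: eq_map => f; rewrite nth_drop.
  rewrite sfs size_drop sw /=.
  have : n * (5 * n + 2 * (2 * n - j) + 12) <= m * (9 * m + 12) by apply: leq_mul => //; lia.
  by rewrite /T -/s; lia.
apply: runs_le.
  rewrite /list_windows; run_step runs_rewind.
  eapply runs_seq; first exact: (@runs_fill true n 0 _ _ _ [::] 0).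
  rewrite subn0 add0n; tape_cbn; run_step runs_rewind; run_step runs_right.
  eapply runs_seq; first exact: (@runs_fill false n 1).
  tape_cbn; run_step runs_append; first by [].
  rewrite subn1 -cats1 -catA -/(window_word n) (_ : n + n.-1 = K); last by rewrite /K; lia.
  run_step runs_rewind; run_step runs_rewind.
  move: loop; rewrite /S drop0 (_ : out 0 = [:: true]) //; exact.
rewrite !size_nseq sw.
have : K * T.+1 <= 2 * m * T.+1 by rewrite leq_mul2r /K; apply/orP; right; lia.
have : 2 * m * T.+1 <= 2 * m * (m * (9 * m + 12) + 2 * m * m + 2 * m + 20).
  by rewrite leq_mul2l /T; apply/orP; right; lia.
by rewrite /K; lia.
Qed.

(** * The common frame of both reductions *)

(** The letter announcing a solution is copied to the output and erased from the answer, so [body]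
    sees only the solution. *)
Definition reduction body :=
  consult ;;
  branch_chart queryT (is_bit true)
    (append outT true ;; erase queryT ;; body) (append outT false) ;;
  rewind outT.

Lemma runs_reduction_solved body n y s o b i q k w l :
  let x := nseq n true ++ false :: y in
  O x = true :: s ->
  runs body
    [:: at_pos x (size x); at_pos s 0; at_pos [:: true] 1; at_pos (nseq n true) n;
        empty; empty] b
    [:: i; q; at_pos o (size o); k; w; l] ->
  runs (reduction body) [:: at_pos x 0; empty; empty; empty; empty; empty]
    (12 * size x + b + 2 * size o + 30) [:: i; q; at_pos o 0; k; w; l].
Proof.
move=> x Ox H; apply: runs_le.
  rewrite /reduction; eapply runs_seq; first exact: runs_consult.
  eapply runs_seq.
    apply: runs_branch; tape_cbn; rewrite is_true_at_pos Ox /=.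
    run_step runs_append; first by [].
    run_step runs_erase.
    exact: H.
  run_last runs_rewind.
by rewrite -/x; lia.
Qed.

Lemma runs_reduction_unsolved body n y :
  let x := nseq n true ++ false :: y in
  O x = [:: false] ->
  exists A, nth blank A outT = at_pos [:: false] 0 /\
  runs (reduction body) [:: at_pos x 0; empty; empty; empty; empty; empty]
    (12 * size x + 30) A.
Proof.
move=> x Ox; eexists; split; last first.
  apply: runs_le.
    rewrite /reduction; eapply runs_seq; first exact: runs_consult.
    eapply runs_seq.
      apply: runs_branch; tape_cbn; rewrite is_true_at_pos Ox /=.
      run_one runs_append; by [].
    tape_cbn; run_one runs_rewind.
  by rewrite -/x -addnA leq_add2l.
by [].
Qed.

End Programs.

(** * Correctness of the reductions *)

(** Running times are plain functions on [nat], within reach of [lia]; this links them to the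
    [{poly nat}] demanded of a reduction. *)
Definition is_polynomial (e : nat -> nat) :=
  exists p : {poly nat}, forall m, (p.[m])%R = e m.

Lemma is_polynomial_id : is_polynomial id.
Proof. by exists 'X%R => m; rewrite hornerX. Qed.

Lemma is_polynomial_const c : is_polynomial (fun _ => c).
Proof. by exists (c%:P)%R => m; rewrite hornerC. Qed.

Lemma is_polynomial_add e f :
  is_polynomial e -> is_polynomial f -> is_polynomial (fun m => e m + f m).
Proof.
by case=> p pe [q qf]; exists (p + q)%R => m; rewrite hornerD pe qf.
Qed.

Lemma is_polynomial_mul e f :
  is_polynomial e -> is_polynomial f -> is_polynomial (fun m => e m * f m).
Proof.
by case=> p pe [q qf]; exists (p * q)%R => m; rewrite hornerM pe qf.
Qed.

Ltac polynomial :=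
  repeat (apply: is_polynomial_add || apply: is_polynomial_mul
          || apply: is_polynomial_const || apply: is_polynomial_id).

Lemma encode_graph_cons (x : anchored_graph) : exists y,
  encode_graph x = nseq (nb_vertices x) true ++ false :: y.
Proof. by eexists; rewrite /encode_graph /unary cat_rcons. Qed.

(* The last entry of the adjacency matrix is on the diagonal, hence 0: it
   separates the matrix from the anchor. *)
Lemma encode_graph_anchor (x : anchored_graph) : exists z,
  encode_graph x = z ++ false :: unary (anchor x).
Proof.
case: x => n G a; rewrite /encode_graph /=.
have : a \in enum 'I_n by rewrite mem_enum.
case/lastP: {1 2 3}(enum 'I_n) => // e u _.
have uu : [set u; u] \in edges G = false.
  apply/negP=> uG; have /forall_inP/(_ _ uG) := edges_card2 G.
  by rewrite setUid cards1.
rewrite map_rcons flatten_rcons map_rcons uu -cats1 catA catA -[rcons _ _]cats1.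
by eexists; rewrite catA -[_ ++ unary a]catA cat1s; reflexivity.
Qed.

Section Reduction.
Variables (solP solQ : anchored_graph -> word -> Prop).
Variables (body : flowchart) (e : nat -> nat).
Hypothesis e_poly : is_polynomial e.
Hypothesis solPQ : forall x s, solP x s -> exists s', solQ x s'.
Hypothesis body_correct : forall O x s, solQ x s ->
  let X := encode_graph x in
  exists i q k w l o,
    [/\ runs O body
          [:: at_pos X (size X); at_pos s 0; at_pos [:: true] 1;
              at_pos (nseq (nb_vertices x) true) (nb_vertices x);
              at_pos [::] 0; at_pos [::] 0]
          (e (size X))
          [:: i; q; at_pos (true :: o) (size (true :: o)); k; w; l],
        size (true :: o) <= e (size X)
      & solP x o].

(** [solPQ] justifies passing on a negative answer: an instance without solution for the oracle's
    problem has none for the other. *)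
Lemma poly_time_reducible_of_body :
  poly_time_reducible (SearchProblem encode_graph solP)
                      (SearchProblem encode_graph solQ).
Proof.
(* One [e m] pays for [body] and [2 * e m] for rewinding its output; the rest covers the
   consultation and the frame. *)
have : is_polynomial (fun m => 12 * m + e m + 2 * e m + 30) by polynomial.
case=> p pe; exists (machine_of (reduction body)), p => O solO x.
have [y Ex] := encode_graph_cons x.
case: (solO x) => [[s sol_s Os]|[Os no_sol]]; rewrite /= in Os.
  have [i [q [k [w [l [o [H so sol_o]]]]]]] := body_correct O sol_s.
  rewrite Ex in H Os; have {}H := runs_reduction_solved Os H.
  have [//|t tb out_t] := @outputs_of_runs O _ _ _ _ (true :: o) H.
  rewrite -Ex in tb out_t.
  exists t, (true :: o); split=> //; last by left; exists o.
  by rewrite pe /=; apply: leq_trans tb _; lia.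
rewrite Ex in Os; have [A [eA H]] := @runs_reduction_unsolved O body _ _ Os.
have [t tb out_t] := outputs_of_runs H eA.
rewrite -Ex in tb out_t.
exists t, [:: false]; split=> //.
  by rewrite pe /=; apply: leq_trans tb _; lia.
by right; split=> // s /solPQ[s' /no_sol].
Qed.

End Reduction.

Lemma nb_vertices_le (x : anchored_graph) : nb_vertices x <= size (encode_graph x).
Proof. by have [y ->] := encode_graph_cons x; rewrite size_cat size_nseq leq_addr. Qed.

Lemma nth_flatten_map T S n (x0 : T) (y0 : S) (f : S -> seq T) (cs : seq S) i j :
  (forall c, size (f c) = n) -> i < n -> j < size cs ->
  nth x0 (flatten (map f cs)) (i + j * n) = nth x0 (f (nth y0 cs j)) i.
Proof.
move=> fn im; elim: cs j => //= c cs IH [|j] jm; rewrite nth_cat fn.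
  by rewrite mul0n addn0 im.
rewrite ltnNge mulSn addnCA leq_addr /= addKn; exact: IH.
Qed.

Lemma size_flatten_map T S n (f : S -> seq T) (cs : seq S) :
  (forall c, size (f c) = n) -> size (flatten (map f cs)) = size cs * n.
Proof. by move=> fn; elim: cs => //= c cs IH; rewrite size_cat fn IH. Qed.

Lemma size_char_vector n (X : {set 'I_n}) : size (char_vector X) = n.
Proof. by rewrite size_map size_enum_ord. Qed.

Lemma encodes_clusters_exists n (L : {set {set 'I_n}}) :
  exists y, encodes_clusters L y.
Proof.
eexists; exists (enum L); split; [exact: enum_uniq | | reflexivity].
by move=> X; rewrite mem_enum.
Qed.

(** The answer is a matrix whose rows are characteristic vectors; a column sum does not depend on
    the order of the rows. *)
Lemma column_count_clusters n (L : {set {set 'I_n}}) (cs : seq {set 'I_n}) (v : 'I_n) :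
  uniq cs -> cs =i L ->
  column_count n (size cs) (flatten [seq char_vector X | X <- cs]) v
    = \sum_(X in L) (v \in X).
Proof.
move=> cs_uniq csL; rewrite -(eq_bigl _ _ csL) -big_uniq // (big_nth set0) big_mkord.
apply: eq_bigr => j _.
rewrite (nth_flatten_map _ set0) ?ltn_ord //; last exact: size_char_vector.
by rewrite (nth_map v) ?nth_ord_enum // size_enum_ord.
Qed.

Lemma arrangement_to_reassembling :
  poly_time_reducible arrangement_problem reassembling_problem.
Proof.
apply: (poly_time_reducible_of_body (body := place_vertices) (e := fun m =>
  50 * m + 60 + m * (2 * m * (7 * m + 9) + 4 * m * m + 20 * m + 60))) => /=.
- by polynomial.
- move=> x _ [phi opt _]; have [/arrangement_position_of[s s_uniq Ephi] _ _] := opt.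
  have [y Hy] := encodes_clusters_exists (linear_tree_of s).
  exists y, (linear_tree_of s) => //.
  by apply: optimal_reassembling_of; rewrite -?Ephi.
move=> O x _ [L opt [cs [cs_uniq csL ->]]].
have [t [t_uniq EL anc opt_t]] := optimal_reassemblingE opt.
set n := nb_vertices x; set m := size _.
have n0 : 0 < n by case: (anchor x) => j /=; apply: leq_ltn_trans.
have nm : n <= m := nb_vertices_le x.
have csK : size cs = 2 * n - 1.
  by rewrite -(card_uniqP cs_uniq) (eq_card csL) EL card_linear_tree // ?card_ord.
have [z Ez] := encode_graph_anchor x.
set s := flatten _.
have [||||i [q [w [l H]]]] := @runs_place_vertices O n (size cs) z (anchor x) s m.
- exact/size_flatten_map/size_char_vector.
- by [].
- by apply: leq_trans nm; apply: ltnW.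
- by rewrite csK; lia.
exists i, q, (at_pos (nseq n true) n), w, l; eexists; split.
- by rewrite -Ez in H; exact: H.
- rewrite /= size_flatten /shape -map_comp.
  rewrite sumnE big_map.
  (* A computed position is at most [n + 2], so its unary code has at most [n + 3] letters. *)
  apply: (@leq_trans (\sum_(i <- iota 0 n) (n.+3)).+1).
    rewrite ltnS; apply: leq_sum => j _ /=; rewrite size_rcons size_nseq ltnS.
    by rewrite /placed; case: eqP => // _; exact: leq_subr.
  rewrite big_const_seq count_predT size_iota iter_addn_0.
  have : n.+3 * n <= m * (20 * m + 60) by rewrite mulnC leq_mul //; lia.
  have := leq_mul (leqnn m) (leq_addl (2 * m * (7 * m + 9) + 4 * m * m) (20 * m + 60)).
  rewrite addnA; lia.
exists (position_of t); first exact: opt_t.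
rewrite /encode_arrangement -val_enum_ord -map_comp; congr flatten.
apply: eq_map => v /=; congr unary.
rewrite (position_of_count v t_uniq anc) /placed -val_eqE; case: ifP => // _.
rewrite (column_count_clusters v cs_uniq csL) EL; congr (_.+2 - _); exact: (esym (card_ord n)).
Qed.

Lemma reassembling_to_arrangement :
  poly_time_reducible reassembling_problem arrangement_problem.
Proof.
apply: (poly_time_reducible_of_body (body := list_windows) (e := fun m =>
  50 * m + 60 + 2 * m * (m * (9 * m + 12) + 2 * m * m + 2 * m + 20))) => /=.
- by polynomial.
- move=> x _ [L /optimal_reassemblingE[s [_ _ _ opt]] _].
  by exists (encode_arrangement (position_of s)), (position_of s).
move=> O x _ [phi opt ->].
have [/arrangement_position_of[t t_uniq Ephi] _ _] := opt.
set n := nb_vertices x; set m := size _.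
have n0 : 0 < n by case: (anchor x) => j /=; apply: leq_ltn_trans.
have nm : n <= m := nb_vertices_le x.
pose fs := [seq phi v | v <- enum 'I_n].
have sfs : size fs = n by rewrite size_map size_enum_ord.
have := @runs_list_windows O n fs m (at_pos (encode_graph x) m).
case=> [||||q [w [l H]]] //.
- apply/allP=> _ /mapP[v _ ->]; rewrite Ephi ffunE /=.
  by apply: leq_trans (index_enumeration t_uniq v) _; rewrite card_ord.
rewrite -map_comp in H.
do 5 eexists; eexists; split; first exact: H.
- rewrite /= (size_flatten_map (n := n)) => [|j]; last by rewrite size_map.
  rewrite size_iota.
  have : (2 * n - 1) * n <= 2 * m * (m * (9 * m + 12)).
    apply: leq_mul; first by lia.
    by apply: leq_trans nm _; rewrite leq_pmulr // addn_gt0 orbT.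
  have := leq_mul (leqnn (2 * m)) (leq_addr (2 * m * m + 2 * m + 20) (m * (9 * m + 12))).
  rewrite !addnA; lia.
exists (linear_tree_of t); first by apply: optimal_reassembling_of; rewrite -?Ephi.
have E : 2 * #|'I_n| - 1 = 2 * n - 1 by rewrite card_ord.
exists [seq window_cluster t j | j <- iota 0 (2 * n - 1)]; split.
- by rewrite -E uniq_windows // card_ord.
- by rewrite -E; exact: mem_windows.
rewrite -map_comp; congr flatten; apply: eq_map => j.
rewrite /= /char_vector -map_comp; apply: eq_map => v /=.
by rewrite inE Ephi ffunE; congr (nth _ (window_word _) _); exact: esym (card_ord n).
Qed.

Theorem theorem5p6 :
  poly_time_reducible arrangement_problem reassembling_problem /\
  poly_time_reducible reassembling_problem arrangement_problem.
Proof.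
exact: conj arrangement_to_reassembling reassembling_to_arrangement.
Qed.
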